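(* Let $n=2k$ and let $F:\mathbb{F}_{2^n}\to\mathbb{F}_{2^n}$, $F(x)=x+(x+x^{2^k}+\delta)^s$, where $\delta\in\mathbb{F}_{2^n}$ and $s$ is any integer in the range $[0,2^n-2]$. Define $g:\mathbb{F}_{2^k}\to\mathbb{F}_{2^k}$ by $$g(y)=y+(y+\delta)^s+(y+\delta)^{2^ks}.$$ Then: (i) $F$ is a permutation of $\mathbb{F}_{2^n}$ if and only if $g$ is bijective. In particular, if $2^ks\equiv s\pmod{2^n-1}$ then $F$ is a permutation. (ii) The Boolean functions $F_\lambda$ are balanced (i.e. $A_\lambda=0$) for all $\lambda\in\mathbb{F}_{2^n}\setminus\mathbb{F}_{2^k}$. If $\lambda\in\mathbb{F}_{2^k}$ then $$A_\lambda=2^k\sum_{y\in\mathbb{F}_{2^k}}(-1)^{T^k_1(\lambda g(y))}.$$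
   Context: For $\lambda\in\mathbb{F}_{2^n}$, $F_\lambda(x)=Tr(\lambda F(x))$, where $Tr$ is the absolute trace $\mathbb{F}_{2^n}\to\mathbb{F}_2$, and $A_\lambda=\sum_{x\in\mathbb{F}_{2^n}}(-1)^{Tr(\lambda F(x))}$. $T^k_1$ denotes the absolute trace $\mathbb{F}_{2^k}\to\mathbb{F}_2$. The convention $z^0=1$ for all $z$ (including $0$) is used. *)

(* Defs.v *)
From HB Require Import structures.
From mathcomp Require Import all_boot all_algebra finfield.

Set Implicit Arguments.
Unset Strict Implicit.
Unset Printing Implicit Defensive.

Import GRing.Theory.
Local Open Scope ring_scope.

(* The field with 2^m elements is any finFieldType of that cardinality, and
   GF(2^k) sits inside GF(2^(2k)) through a ring morphism iota (necessarily
   injective). *)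

(* Absolute trace x + x^2 + ... + x^(2^(m-1)) of the field with 2^m elements.
   The sum is 0 or 1 in F and is read as an element of 'F_2: see abs_traceE. *)
Definition abs_trace (F : finFieldType) (m : nat) (x : F) : 'F_2 :=
  (\sum_(i < m) x ^+ (2 ^ i) != 0)%:R.

Definition sign_sum (T : finType) (f : T -> 'F_2) : int :=
  \sum_(x : T) (-1) ^+ (nat_of_ord (f x)).

Definition balanced (T : finType) (f : T -> 'F_2) : bool :=
  #|[set x | f x == 0]| == #|[set x | f x == 1]|.

Definition Fmap (L : finFieldType) (k : nat) (delta : L) (s : nat) (x : L) : L :=
  x + (x + x ^+ (2 ^ k) + delta) ^+ s.

Definition gval (K L : finFieldType) (iota : {rmorphism K -> L})
    (k : nat) (delta : L) (s : nat) (y : K) : L :=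
  iota y + (iota y + delta) ^+ s + (iota y + delta) ^+ (2 ^ k * s).

(* gval takes its values in the image of iota, and gmap pulls it back to K; the
   default value 0 is never used: see iota_gmap. *)
Definition gmap (K L : finFieldType) (iota : {rmorphism K -> L})
    (k : nat) (delta : L) (s : nat) (y : K) : K :=
  odflt 0 [pick z | iota z == gval iota k delta s y].

Lemma exprD_pow2 (F : finFieldType) (m i : nat) (x y : F) :
  #|F| = (2 ^ m)%N -> (x + y) ^+ (2 ^ i) = x ^+ (2 ^ i) + y ^+ (2 ^ i).
Proof.
move=> hF; have p2 := card_finPcharP hF (isT : prime 2).
by rewrite exprDn_pchar // (eq_pnat _ (pcharf_eq p2)) pnatX pnat_id.
Qed.

Lemma abs_traceE (F : finFieldType) (m : nat) (x : F) : #|F| = (2 ^ m)%N ->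
  (nat_of_ord (abs_trace m x))%:R = \sum_(i < m) x ^+ (2 ^ i).
Proof.
move=> hF; rewrite /abs_trace; set t := \sum_(i < m) _.
have m0 : (0 < m)%N.
  by case: m hF @t => // hF; have := finNzRing_gt1 F; rewrite hF.
have tt : t ^+ 2 = t.
  have sq (r : seq 'I_m) : (\sum_(i <- r) x ^+ (2 ^ i)) ^+ 2 =
      \sum_(i <- r) x ^+ (2 ^ i.+1).
    elim: r => [|j r IH]; first by rewrite !big_nil expr0n.
    by rewrite !big_cons (exprD_pow2 1 _ _ hF) IH -exprM -expnSr.
  rewrite /t sq; case: m m0 hF {t sq} => // m _ hF.
  by rewrite big_ord_recr big_ord_recl /= -hF addrC [_ ^+ #|_|](expf_card x) expr1.
case: (eqVneq t 0) => [->|t0] //=.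
by apply: (mulIf t0); rewrite mul1r -expr2 tt.
Qed.

Lemma iota_gmap (K L : finFieldType) (iota : {rmorphism K -> L})
    (k : nat) (delta : L) (s : nat) (y : K) :
  #|K| = (2 ^ k)%N -> #|L| = (2 ^ (2 * k))%N ->
  iota (gmap iota k delta s y) = gval iota k delta s y.
Proof.
move=> hK hL; rewrite /gmap; case: pickP => [z /eqP //|nz] /=.
set z := gval iota k delta s y in nz *.
have zz : z ^+ (2 ^ k) = z.
  have fixK : y ^+ (2 ^ k) = y by rewrite -hK; exact: expf_card.
  have fixL (u : L) : u ^+ (2 ^ (2 * k)) = u by rewrite -hL; exact: expf_card.
  rewrite /z /gval !(exprD_pow2 k _ _ hL) -rmorphXn /= fixK -!exprM.
  by rewrite mulnAC -expnD addnn -mul2n (exprM _ (2 ^ (2 * k))) fixL (mulnC s) addrAC.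
have /(congr1 (fun p => (map_poly iota p).[z])) := finField_genPoly K.
rewrite hK rmorphB /= map_polyXn map_polyX !hornerE zz subrr.
rewrite rmorph_prod horner_prod => /esym/eqP/prodf_eq0[x _].
by rewrite rmorphB /= map_polyX map_polyC !hornerE subr_eq0 eq_sym nz.
Qed.

(* Main.v *)
Require Import Defs.
From mathcomp Require Import all_boot all_algebra.
From mathcomp Require Import finfield.

Set Implicit Arguments.
Unset Strict Implicit.
Unset Printing Implicit Defensive.

Import GRing.Theory.
Local Open Scope ring_scope.

(* Write q = 2^k, p(x) = x + x^q for the trace of L over K, and
   h(y) = (y + delta)^s, so that F(x) = x + h(p(x)).  Since p(h) = h + h^q, the
   map p intertwines the two maps: p(F(x)) = g(p(x)).  Hence F is onto only if g
   is, and F is injective if g is, because F(x) and p(x) determine x.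
   For the sums, F(x + c) = F(x) + c for c in K, so A_lambda is invariant under
   multiplication by (-1)^Tr(lambda c) = (-1)^T(c p(lambda)); this sign is not
   always 1 when p(lambda) != 0, that is, when lambda is outside K.  When lambda
   is in K, Tr(lambda F(x)) = T(lambda g(p(x))), and p has fibres of size q. *)

Lemma pow2_card_addrr (F : finFieldType) (m : nat) (x : F) :
  #|F| = (2 ^ m)%N -> x + x = 0.
Proof. by move=> hF; exact: (addrr_pchar2 (card_finPcharP hF isT)). Qed.

(** Over K, X^|K| - X is the product of all X - y. Mapped through [iota], this factorization shows
    that a root in L must be some [iota y]. *)
Lemma frobenius_fixed_codom (K L : finFieldType) (iota : {rmorphism K -> L})
    (z : L) :
  (z \in codom iota) = (z ^+ #|K| == z).
Proof.
apply/codomP/eqP => [[y ->]|zz]; first by rewrite -rmorphXn /= expf_card.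
have /(congr1 (fun p => (map_poly iota p).[z])) := finField_genPoly K.
rewrite rmorphB /= map_polyXn map_polyX !hornerE zz subrr.
rewrite rmorph_prod horner_prod => /esym/eqP/prodf_eq0[y _].
rewrite rmorphB /= map_polyX map_polyC !hornerE subr_eq0 => /eqP zE.
by exists y.
Qed.

Section TraceSign.

Variables (F : finFieldType) (m : nat).
Hypothesis hF : #|F| = (2 ^ m)%N.

(** The canonical additive character of [F]. *)
Definition trace_sign (x : F) : int := (-1) ^+ (nat_of_ord (abs_trace m x)).

Lemma trace_signE x :
  trace_sign x = if \sum_(i < m) x ^+ (2 ^ i) == 0 then 1 else -1.
Proof. by rewrite /trace_sign /abs_trace; case: eqP. Qed.

Lemma trace_signD x y : trace_sign (x + y) = trace_sign x * trace_sign y.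
Proof.
have tD : \sum_(i < m) (x + y) ^+ (2 ^ i)
    = \sum_(i < m) x ^+ (2 ^ i) + \sum_(i < m) y ^+ (2 ^ i).
  by rewrite -big_split; apply: eq_bigr => i _; rewrite (exprD_pow2 _ _ _ hF).
rewrite !trace_signE tD.
(* By [abs_traceE] each sum is 0 or 1, so four cases remain, the last one being 1 + 1 = 0. *)
have := abs_traceE x hF; have := abs_traceE y hF; rewrite /abs_trace.
move: (\sum_(i < m) x ^+ _) (\sum_(i < m) y ^+ _) => t u.
have [->|_] := eqVneq u 0; have [->|_] /= := eqVneq t 0.
- by rewrite addr0 eqxx.
- by move=> _ <-; rewrite addr0 oner_eq0.
- by move=> <- _; rewrite add0r oner_eq0.
- by move=> <- <-; rewrite (pow2_card_addrr _ hF) eqxx.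
Qed.

(* Otherwise all 2^m elements are roots of the trace polynomial, whose degree is
   2^(m-1). *)
Lemma trace_sign_nontrivial : exists x, trace_sign x = -1.
Proof.
have m0 : (0 < m)%N.
  by case: m hF => // h; have := finNzRing_gt1 F; rewrite h.
case: (pickP (fun x => trace_sign x == -1)) => [x /eqP|none]; first by exists x.
have m1 : (m.-1 < m)%N by rewrite prednK.
pose P : {poly F} := \sum_(i < m) 'X^(2 ^ i).
have rootP x : root P x.
  have Px : P.[x] = \sum_(i < m) x ^+ (2 ^ i).
    by rewrite horner_sum; apply: eq_bigr => i _; rewrite hornerXn.
  by have := none x; rewrite trace_signE rootE Px; case: ifP; rewrite ?eqxx.
have sizeP : (size P <= (2 ^ m.-1).+1)%N.
  apply: (leq_trans (size_sum _ _ _)); apply/bigmax_leqP => i _.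
  by rewrite size_polyXn ltnS leq_pexp2l // -ltnS prednK.
(* The exponents 2^i are distinct, so only i = m - 1 contributes to the coefficient of degree
   2^(m-1), which is 1. *)
have P0 : P != 0.
  apply/eqP => /(congr1 (fun p : {poly F} => p`_(2 ^ m.-1))).
  rewrite coef0 coef_sum (bigD1 (Ordinal m1)) //= coefXn eqxx.
  rewrite big1 ?addr0; first by move/eqP; rewrite oner_eq0.
  move=> i ni; rewrite coefXn eqn_exp2l //; case: eqP => // e.
  by case/eqP: ni; apply: val_inj.
have allP_F : all (root P) (enum F) by apply/allP.
have := leq_trans (max_poly_roots P0 allP_F (enum_uniq F)) sizeP.
by rewrite -cardE hF ltnS leq_exp2l // leqNgt m1.
Qed.

End TraceSign.

(** The sign sum is the number of zeros of [f] minus the number of its ones. *)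
Lemma balanced_sign_sum (T : finType) (f : T -> 'F_2) :
  balanced f = (sign_sum f == 0).
Proof.
have f01 x : (f x == 0) || (f x == 1) by case: (f x) => [[|[|]]].
rewrite /sign_sum (bigID (fun x => f x == 0)) /=.
rewrite (eq_bigr (fun=> 1)) => [|x /eqP->//].
rewrite [X in _ + X](eq_big (fun x => f x == 1) (fun=> -1)); last 2 first.
- by move=> x; have := f01 x; case: (f x) => [[|[|]]].
- by move=> x; have := f01 x; case: (f x) => [[|[|]]].
rewrite !sumr_const mulNrn subr_eq0 /balanced !cardsE.
by rewrite !natz.
Qed.

Section QuadraticExtension.

Variables (K L : finFieldType) (iota : {rmorphism K -> L}) (k : nat).
Hypotheses (hK : #|K| = (2 ^ k)%N) (hL : #|L| = (2 ^ (2 * k))%N).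

(* The default value 0 is never used: see iota_rel_trace. *)
Definition rel_trace (x : L) : K :=
  odflt 0 [pick z | iota z == x + x ^+ (2 ^ k)].

Lemma iota_rel_trace x : iota (rel_trace x) = x + x ^+ (2 ^ k).
Proof.
rewrite /rel_trace; case: pickP => [z /eqP //|nz].
have /codomP[z zE] : x + x ^+ (2 ^ k) \in codom iota.
  rewrite frobenius_fixed_codom hK (exprD_pow2 _ _ _ hL) -exprM -expnD addnn.
  by rewrite -mul2n -hL expf_card addrC.
by have := nz z; rewrite zE eqxx.
Qed.

Lemma rel_traceD x y : rel_trace (x + y) = rel_trace x + rel_trace y.
Proof.
apply: (fmorph_inj iota).
by rewrite rmorphD !iota_rel_trace (exprD_pow2 _ _ _ hL) addrACA.
Qed.

Lemma rel_traceZ c x : rel_trace (iota c * x) = c * rel_trace x.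
Proof.
apply: (fmorph_inj iota).
rewrite rmorphM !iota_rel_trace exprMn -rmorphXn /= -hK expf_card.
by rewrite mulrDr.
Qed.

(** In characteristic 2, x + x^q = 0 says that x is fixed by the q-power map. *)
Lemma rel_trace_eq0 x : (rel_trace x == 0) = (x \in codom iota).
Proof.
rewrite frobenius_fixed_codom -(fmorph_eq0 iota) iota_rel_trace hK.
by rewrite addrC addr_eq0 (addr0_eq (pow2_card_addrr x hL)).
Qed.

Lemma rel_trace_iota c : rel_trace (iota c) = 0.
Proof. by apply/eqP; rewrite rel_trace_eq0 codom_f. Qed.

(** Any u outside K has nonzero relative trace, which a factor from K rescales to 1. *)
Lemma rel_trace_eq1 : exists u, rel_trace u = 1.
Proof.
case: (pickP (fun u => u \notin codom iota)) => [u|all_K].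
  rewrite -rel_trace_eq0 => u0.
  by exists (iota (rel_trace u)^-1 * u); rewrite rel_traceZ mulVf.
have : (#|L| <= #|K|)%N.
  rewrite -(card_codom (fmorph_inj iota)); apply: subset_leq_card.
  by apply/subsetP => x _; apply: negbFE (all_K x).
(* If K were all of L, then 2k <= k, so k = 0 and K would have a single element. *)
rewrite hL hK leq_exp2l // mul2n -addnn -[leqRHS]addn0 leq_add2l.
rewrite leqn0 => /eqP k0.
by have := finNzRing_gt1 K; rewrite hK k0.
Qed.

Lemma rel_trace_surj y : exists x, rel_trace x = y.
Proof.
have [u u1] := rel_trace_eq1.
by exists (iota y * u); rewrite rel_traceZ u1 mulr1.
Qed.

Lemma sum_rel_trace (f : K -> int) :
  \sum_(x : L) f (rel_trace x) = 2 ^+ k * \sum_(y : K) f y.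
Proof.
(* The decomposition L = K + K u is a bijection K * K -> L under which p is the
   second projection. *)
have [u u1] := rel_trace_eq1.
pose w (cy : K * K) : L := iota cy.1 + iota cy.2 * u.
have wE cy : rel_trace (w cy) = cy.2.
  by rewrite rel_traceD rel_trace_iota rel_traceZ u1 add0r mulr1.
have w_inj : injective w.
  move=> [c y] [c' y'] e; have := congr1 rel_trace e.
  rewrite !wE /= => yy; move: e; rewrite /w /= yy.
  by move/addIr/(fmorph_inj iota) => ->.
have w_bij : bijective w.
  by apply: inj_card_bij w_inj _; rewrite card_prod hK hL -expnD addnn mul2n.
rewrite (reindex w) /=; last exact: onW_bij.
rewrite (eq_bigr (fun cy => f cy.2)) => [|cy _]; last by rewrite wE.
rewrite -(pair_bigA _ (fun _ y => f y)) /= sumr_const hK.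
by rewrite -[LHS]mulr_natl natrX.
Qed.

(** Transitivity of the trace: the terms i and k + i of the absolute trace of x add up to (x +
    x^q)^(2^i). *)
Lemma trace_sign_rel_trace x : trace_sign (2 * k) x = trace_sign k (rel_trace x).
Proof.
rewrite !trace_signE -(fmorph_eq0 iota) rmorph_sum.
suff -> : \sum_(i < 2 * k) x ^+ (2 ^ i)
    = \sum_(i < k) iota (rel_trace x ^+ (2 ^ i)) by [].
rewrite mul2n -addnn big_split_ord /= -big_split; apply: eq_bigr => i _ /=.
by rewrite rmorphXn /= iota_rel_trace (exprD_pow2 _ _ _ hL) -exprM -expnD.
Qed.

Variables (delta : L) (s : nat).
Let F := Fmap k delta s.
Let g := gmap iota k delta s.

Lemma FmapE x : F x = x + (iota (rel_trace x) + delta) ^+ s.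
Proof. by rewrite iota_rel_trace. Qed.

Lemma rel_trace_Fmap x : rel_trace (F x) = g (rel_trace x).
Proof.
apply: (fmorph_inj iota); rewrite FmapE rel_traceD rmorphD iota_gmap // /gval.
by rewrite [X in _ + X]iota_rel_trace addrA -exprM (mulnC s).
Qed.

Lemma FmapD_iota x c : F (x + iota c) = F x + iota c.
Proof. by rewrite !FmapE rel_traceD rel_trace_iota addr0 addrAC. Qed.

Lemma Fmap_bijective : bijective F <-> bijective g.
Proof.
split=> [[F' _ FK']|g_bij].
  have g_surj y : exists z, g z == y.
    have [x <-] := rel_trace_surj y.
    by exists (rel_trace (F' x)); rewrite -rel_trace_Fmap FK'.
  (* A section [g'] of [g] is injective, hence bijective on the finite set K, hence a two-sided
     inverse of [g]. *)
  pose g' y := xchoose (g_surj y).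
  have gK' : cancel g' g by move=> y; exact/eqP/(xchooseP (g_surj y)).
  have [h h1 h2] := injF_bij (can_inj gK').
  exists g' => // z.
  by rewrite -[z in LHS]h2 gK' h2.
apply: injF_bij => x x' e.
have pp : rel_trace x = rel_trace x'.
  by apply: (bij_inj g_bij); rewrite -!rel_trace_Fmap e.
by move: e; rewrite !FmapE pp => /addIr.
Qed.

(** The two powers in g agree, so they cancel in characteristic 2. *)
Lemma gmap_id : (2 ^ k * s = s %[mod 2 ^ (2 * k) - 1])%N -> g =1 id.
Proof.
move=> hs y; apply: (fmorph_inj iota); rewrite iota_gmap // /gval.
set z := iota y + delta.
suff -> : z ^+ (2 ^ k * s) = z ^+ s.
  by rewrite -addrA (pow2_card_addrr _ hL) addr0.
(* At z = 0 the exponents [2 ^ k * s] and [s] vanish together, so the powers are both 1 or both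
   0. *)
have [->|z0] := eqVneq z 0.
  by rewrite !expr0n muln_eq0 expn_eq0.
have z1 : z ^+ (2 ^ (2 * k) - 1) = 1.
  apply: (mulIf z0); rewrite -exprSr subn1 prednK ?expn_gt0 //.
  by rewrite -hL expf_card mul1r.
by rewrite -(expr_mod _ z1) hs expr_mod.
Qed.

Lemma sum_trace_sign_Fmap_notin (lambda : L) : lambda \notin codom iota ->
  \sum_(x : L) trace_sign (2 * k) (lambda * F x) = 0.
Proof.
rewrite -rel_trace_eq0 => l0; set S := \sum_(x : L) _.
have [c c1] := trace_sign_nontrivial hK.
(* Chosen so that p(lambda d) = d p(lambda) = c: translating by d then flips every sign. *)
pose d := c / rel_trace lambda.
have SN : S = - S.
  rewrite {1}/S (reindex (fun x => x + iota d)) /=; last first.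
    by apply: onW_bij; exists (fun x => x - iota d) => x; rewrite ?addrK ?subrK.
  rewrite -sumrN; apply: eq_bigr => x _.
  rewrite FmapD_iota mulrDr (trace_signD hL) [lambda * iota d]mulrC.
  rewrite [trace_sign _ (iota d * _)]trace_sign_rel_trace rel_traceZ.
  by rewrite divfK // c1 mulrN1.
by apply/eqP; rewrite -Num.Theory.eqNr -SN.
Qed.

Lemma sum_trace_sign_Fmap_in (lambda : K) :
  \sum_(x : L) trace_sign (2 * k) (iota lambda * F x)
  = 2 ^+ k * \sum_(y : K) trace_sign k (lambda * g y).
Proof.
rewrite -(sum_rel_trace (fun y => trace_sign k (lambda * g y))).
by apply: eq_bigr => x _; rewrite trace_sign_rel_trace rel_traceZ rel_trace_Fmap.
Qed.

End QuadraticExtension.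

Theorem proposition8 (n k : nat) (hn : n = (2 * k)%N)
    (L K : finFieldType) (hL : #|L| = (2 ^ n)%N) (hK : #|K| = (2 ^ k)%N)
    (iota : {rmorphism K -> L})
    (delta : L) (s : nat) (hs : (s <= 2 ^ n - 2)%N) :
  [/\ bijective (Fmap k delta s) <-> bijective (gmap iota k delta s),
      (2 ^ k * s = s %[mod 2 ^ n - 1])%N -> bijective (Fmap k delta s),
      forall lambda : L, lambda \notin codom iota ->
        balanced (fun x : L => abs_trace n (lambda * Fmap k delta s x)) /\
        sign_sum (fun x : L => abs_trace n (lambda * Fmap k delta s x)) = 0
    & forall lambda : K,
        sign_sum (fun x : L => abs_trace n (iota lambda * Fmap k delta s x)) =
        2 ^+ k *
        sign_sum (fun y : K => abs_trace k (lambda * gmap iota k delta s y))].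
Proof.
subst n; split.
- exact: Fmap_bijective.
- move=> /(gmap_id iota hK hL delta) g_id; apply/(Fmap_bijective iota hK hL).
  by exists id => y; rewrite g_id.
- move=> lambda lK; rewrite balanced_sign_sum.
  by have S0 := sum_trace_sign_Fmap_notin hK hL delta s lK;
    rewrite [sign_sum _]S0.
- by move=> lambda; exact: sum_trace_sign_Fmap_in.
Qed.
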